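(* Let $G$ be an outer-planar group satisfying the ascending and descending chain conditions on subgroups. Then $G$ is finite, and hence $G$ is isomorphic to $\mathbb{Z}_{p^m}$ or $\mathbb{Z}_{p^mq}$ for some distinct primes $p,q$ and some non-negative integer $m$.
   Context: For a group $G$, the subgroup graph $\mathcal{L}(G)$ is the graph whose vertices are all subgroups of $G$, two subgroups $H,K$ being adjacent if one of them is a maximal subgroup of the other. A graph is outer-planar if it has a planar embedding in which every vertex lies on the boundary of the unbounded face. $G$ is an outer-planar group if $\mathcal{L}(G)$ is outer-planar. $\mathbb{Z}_n$ denotes the cyclic group of order $n$. *)

(* Defs.v *)
From HB Require Import structures.
From mathcomp Require Import all_boot all_order all_algebra.
From mathcomp Require Import boolp classical_sets cardinality reals topology normedtype.
Set Implicit Arguments. Unset Strict Implicit. Unset Printing Implicit Defensive.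
Import Order.TTheory GRing.Theory Num.Theory.
Local Open Scope classical_set_scope.
Local Open Scope ring_scope.
Import numFieldNormedType.Exports.

Record AbsGroup := MkGroup {
  gcar :> Type;
  gmul : gcar -> gcar -> gcar;
  gone : gcar;
  ginv : gcar -> gcar;
  gmulA : forall x y z, gmul x (gmul y z) = gmul (gmul x y) z;
  gmul1 : forall x, gmul gone x = x;
  gmulV : forall x, gmul (ginv x) x = gone }.

Definition is_subgroup (G : AbsGroup) (H : set G) : Prop :=
  H (gone G) /\ (forall x y, H x -> H y -> H (gmul x y)) /\
  (forall x, H x -> H (ginv x)).

Definition subgroup (G : AbsGroup) := {H : set G | is_subgroup H}.

Definition maximal_in (G : AbsGroup) (H K : subgroup G) : Prop :=
  proj1_sig H `<=` proj1_sig K /\ proj1_sig H <> proj1_sig K /\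
  (forall L : subgroup G, proj1_sig H `<=` proj1_sig L ->
     proj1_sig L `<=` proj1_sig K ->
     proj1_sig L = proj1_sig H \/ proj1_sig L = proj1_sig K).

Definition subgroup_adj (G : AbsGroup) (H K : subgroup G) : Prop :=
  maximal_in H K \/ maximal_in K H.

Definition ACC_subgroups (G : AbsGroup) : Prop :=
  forall c : nat -> subgroup G,
    (forall n, proj1_sig (c n) `<=` proj1_sig (c n.+1)) ->
    exists N, forall n, (N <= n)%N -> proj1_sig (c n) = proj1_sig (c N).

Definition DCC_subgroups (G : AbsGroup) : Prop :=
  forall c : nat -> subgroup G,
    (forall n, proj1_sig (c n.+1) `<=` proj1_sig (c n)) ->
    exists N, forall n, (N <= n)%N -> proj1_sig (c n) = proj1_sig (c N).

Section Plane.
Variable R : realType.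

Definition unit_interval : set R := [set t | 0 <= t <= 1].
Definition open_unit_interval : set R := [set t | 0 < t < 1].

Definition bounded_plane (A : set (R * R)) : Prop :=
  exists M : R, forall p, A p -> `|p.1| <= M /\ `|p.2| <= M.

Record planar_embedding (V : Type) (adj : V -> V -> Prop) := PlanarEmb {
  pe_pos : V -> R * R;
  pe_arc : V -> V -> R -> R * R;
  pe_pos_inj : forall u v, pe_pos u = pe_pos v -> u = v;
  pe_arc_cont : forall u v, adj u v ->
    {within unit_interval, continuous (pe_arc u v)};
  pe_arc_inj : forall u v, adj u v -> forall s t, unit_interval s ->
    unit_interval t -> pe_arc u v s = pe_arc u v t -> s = t;
  pe_arc0 : forall u v, adj u v -> pe_arc u v 0 = pe_pos u;
  pe_arc1 : forall u v, adj u v -> pe_arc u v 1 = pe_pos v;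
  pe_arc_rev : forall u v, adj u v -> forall t, unit_interval t ->
    pe_arc v u t = pe_arc u v (1 - t);
  pe_arc_vertex : forall u v w, adj u v -> forall t, open_unit_interval t ->
    pe_arc u v t <> pe_pos w;
  pe_arc_disj : forall u v u' v', adj u v -> adj u' v' ->
    ~ ((u = u' /\ v = v') \/ (u = v' /\ v = u')) ->
    forall s t, open_unit_interval s -> open_unit_interval t ->
    pe_arc u v s <> pe_arc u' v' t }.

Definition drawing V (adj : V -> V -> Prop) (e : planar_embedding adj)
  : set (R * R) :=
  range (pe_pos e) `|`
  [set p | exists u v t, adj u v /\ unit_interval t /\ p = pe_arc e u v t].

Definition is_face V (adj : V -> V -> Prop) (e : planar_embedding adj)
  (F : set (R * R)) : Prop :=
  exists x, (~` drawing e) x /\ F = connected_component (~` drawing e) x.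

Definition outer_planar V (adj : V -> V -> Prop) : Prop :=
  exists e : planar_embedding adj, exists F, is_face e F /\
    ~ bounded_plane F /\ forall v, closure F (pe_pos e v).

End Plane.

Definition outer_planar_group (R : realType) (G : AbsGroup) : Prop :=
  outer_planar R (@subgroup_adj G).

Definition iso_Zn (G : AbsGroup) (n : nat) : Prop :=
  (0 < n)%N /\ exists f : G -> nat,
    (forall x y, f x = f y -> x = y) /\
    (forall k, (k < n)%N <-> exists x, f x = k) /\
    (forall x y, f (gmul x y) = ((f x + f y) %% n)%N).

Definition finite_group (G : AbsGroup) : Prop := finite_set (@setT G).

(* Main.v *)
(** Three pairwise incomparable subgroups M_0, M_1, M_2 would produce a drawing
    of K_{3,3}: by the chain conditions the lattice contains paths from the
    trivial subgroup to M_i inside [1, M_i], and from M_i to G inside [M_i, G],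
    and those with different indices do not meet; moreover every M_i lies in the
    closure of the outer face F, so a point of F can be joined to each M_i by a
    path which, except very near M_i, stays in F. In this drawing disjoint edges
    of K_{3,3} do not meet, which contradicts a parity argument on winding
    numbers. Hence the subgroup lattice has width at most two. The maximal cyclic
    subgroups form an antichain covering G, so there are at most two of them, and
    G, not being a union of two proper subgroups, is cyclic; an antichain of three
    divisors would again give three incomparable subgroups, so the order of G is
    nonzero and of the form p^m or p^m q. *)

Require Import Defs.
From Stdlib Require Ring.
From mathcomp Require Import all_boot all_order all_algebra.
From mathcomp Require Import boolp classical_sets cardinality reals topology normedtype.
From mathcomp Require Import lra zify.

(** * Parity of crossings *)

Section Parity.
Import Stdlib.setoid_ring.Ring.
Import Order.TTheory GRing.Theory Num.Theory.
Local Open Scope ring_scope.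
Variable R : realFieldType.
Implicit Types (p q w : R * R) (s t : seq (R * R)) (d : R).

(* Half-plane containing exactly one of p and - p, for p != 0. *)
Definition lexpos p := (0 < p.2) || ((p.2 == 0) && (0 < p.1)).

(* The segment from p to q, if short and far from 0, passes the positive
   horizontal half-axis: the parity of such passages plays the role of a
   winding number around 0. *)
Definition cross p q := (lexpos p (+) lexpos q) && (0 < p.1).

Fixpoint crossings (f : R * R -> R * R) p s :=
  if s is q :: s' then cross (f p) (f q) (+) crossings f q s' else false.

Definition near2 d p q := (`|p.1 - q.1| < d) && (`|p.2 - q.2| < d).

Lemma lexposN p q : p != q -> lexpos (q - p) = ~~ lexpos (p - q).
Proof.
case: p q => [x y] [x' y']; rewrite /lexpos /= xpair_eqE negb_and => nz.
rewrite !subr_gt0 !subr_eq0 (eq_sym y').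
by case: (ltrgtP y y') nz => //= _; case: (ltrgtP x x').
Qed.

Lemma lexpos_near d p q : near2 d p q -> d <= `|p.2| -> lexpos p = lexpos q.
Proof.
case/andP=> _; rewrite /lexpos ltr_norml ler_normr => /andP[a b] /orP[] c.
  have -> : 0 < p.2 by lra.
  by have -> : 0 < q.2 by lra.
have -> : (0 < p.2) = false by apply/negbTE; lra.
have -> : (0 < q.2) = false by apply/negbTE; lra.
have -> : (p.2 == 0) = false by apply/negbTE; lra.
by have -> : (q.2 == 0) = false by apply/negbTE; lra.
Qed.

Lemma pos_near d p q : near2 d p q -> d <= `|p.1| -> (0 < p.1) = (0 < q.1).
Proof.
case/andP=> + _; rewrite ltr_norml ler_normr => /andP[a b] /orP[] c.
  have -> : 0 < p.1 by lra.
  by have -> : 0 < q.1 by lra.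
have -> : (0 < p.1) = false by apply/negbTE; lra.
by have -> : (0 < q.1) = false by apply/negbTE; lra.
Qed.

Lemma near2_refl d p : 0 < d -> near2 d p p.
Proof. by move=> d0; rewrite /near2 !subrr normr0 d0. Qed.

Lemma near2_sub d p p' q q' :
  near2 d p p' -> near2 d q q' -> near2 (2 * d) (p - q) (p' - q').
Proof.
by rewrite /near2 /= !ltr_norml => /andP[/andP[? ?] /andP[? ?]]
  /andP[/andP[? ?] /andP[? ?]]; apply/andP; split; apply/andP; split; lra.
Qed.

(** If the first coordinates are far apart, the first coordinates of all the differences have one
    sign and both sides telescope in [lexpos]; if the second coordinates are, all four values of
    [lexpos] agree and no side crosses. *)
Lemma cross_cell d p p' q q' : 0 < d ->
  near2 d p p' -> near2 d q q' -> ~~ near2 (2 * d) p q ->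
  cross (p - q) (p' - q) (+) cross (p - q') (p' - q') =
  cross (p - q) (p - q') (+) cross (p' - q) (p' - q').
Proof.
move=> d0 pp qq.
have n1 : near2 (2 * d) (p - q) (p' - q) by apply/near2_sub/near2_refl.
have n2 : near2 (2 * d) (p - q) (p - q') by apply/near2_sub/qq/near2_refl.
have n3 : near2 (2 * d) (p - q) (p' - q') by apply/near2_sub.
rewrite /near2 negb_and -!leNgt => /orP[far|far]; rewrite /cross.
  rewrite -(pos_near _ _ _ n1)// -(pos_near _ _ _ n2)//.
  by case: (0 < _); rewrite ?andbF ?andbT //; do 4 case: (lexpos _).
by rewrite -(lexpos_near _ _ _ n1)// -(lexpos_near _ _ _ n2)//
  -(lexpos_near _ _ _ n3)// addbb.
Qed.

Definition far_apart d s t := forall p q, p \in s -> q \in t -> ~~ near2 d p q.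

(** Sum of the cell identities along [t]: a side shared by neighbouring cells occurs twice and
    cancels. *)
Lemma crossings_strip d p p' q t : 0 < d ->
  near2 d p p' -> path (near2 d) q t -> far_apart (2 * d) [:: p] (q :: t) ->
  crossings (fun z => p - z) q t (+) crossings (fun z => p' - z) q t =
  cross (p - q) (p' - q) (+) cross (p - last q t) (p' - last q t).
Proof.
move=> d0 pp; elim: t q => [|q' t IH] q /= => [_ _|/andP[qq qt] far].
  by rewrite addbb.
have {}IH := IH q' qt; rewrite addbACA IH; last first.
  by move=> a b ap bq; apply: far => //; rewrite inE bq orbT.
rewrite -(cross_cell d)//; last by apply: far; rewrite inE eqxx.
by rewrite -!addbA; congr addb; rewrite !addbA addbb.
Qed.

(* The difference map (z, w) |-> z - w avoids 0 on the product of the two paths,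
   so its winding along the boundary of the grid vanishes. *)
Lemma crossings_grid d p s q t : 0 < d ->
  path (near2 d) p s -> path (near2 d) q t ->
  far_apart (2 * d) (p :: s) (q :: t) ->
  crossings (fun z => p - z) q t (+) crossings (fun z => last p s - z) q t =
  crossings (fun z => z - q) p s (+) crossings (fun z => z - last q t) p s.
Proof.
move=> d0 + qt; elim: s p => [|p' s IH] p /= => [_ _|/andP[pp ps] far].
  by rewrite addbb.
have {}IH := IH p' ps; rewrite addbACA -IH; last first.
  by move=> a b ap bq; apply: far => //; rewrite inE ap orbT.
rewrite -(crossings_strip d)//; last first.
  by move=> a b; rewrite inE => /eqP-> bq; apply: far => //; rewrite inE eqxx.
by rewrite -!addbA; congr addb; rewrite !addbA addbb.
Qed.

(* Reflecting a path at the origin exchanges its crossings of the two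
   half-axes, and the crossings of the whole axis are counted by the ends. *)
Lemma crossings_opp d p q t : 0 < d ->
  path (near2 d) q t -> far_apart d [:: p] (q :: t) ->
  crossings (fun z => p - z) q t (+) crossings (fun z => z - p) q t =
  lexpos (p - q) (+) lexpos (p - last q t).
Proof.
move=> d0; elim: t q => [|q' t IH] q /= => [_ _|/andP[qq qt] far].
  by rewrite addbb.
have {}IH := IH q' qt; rewrite addbACA IH; last first.
  by move=> a b ap bq; apply: far => //; rewrite inE bq orbT.
have nq : ~~ near2 d p q by apply: far; rewrite inE eqxx.
have nq' : ~~ near2 d p q' by apply: far; rewrite !inE eqxx ?orbT.
have pq : p != q by apply: contra nq => /eqP->; exact: near2_refl.
have pq' : p != q' by apply: contra nq' => /eqP->; exact: near2_refl.
rewrite {1 2}/cross (lexposN p q)// (lexposN p q')// addbN addNb negbK.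
set l := lexpos (p - q); set l' := lexpos (p - q').
have [ll|ll] := boolP (l (+) l'); last first.
  by move: ll; rewrite negb_add => /eqP->.
(* A change of [lexpos] is counted on exactly one half-axis, provided the first coordinates differ.
   Equal ones would put [p] and [q] at least [d] apart vertically, and one short step could not
   change [lexpos]. *)
suff -> : (0 < (q - p).1) = ~~ (0 < (p - q).1).
  by case: (0 < _); move: ll; case: l; case: l'; case: (lexpos _).
rewrite /= subr_gt0 subr_gt0 -leNgt lt_neqAle andb_idl // => _.
apply: contraT; rewrite negbK => /eqP e.
move: nq; rewrite /near2 e subrr normr0 d0 /= -leNgt => far2.
have qq2 : near2 d (p - q) (p - q').
  by move: qq; rewrite /near2 /= !ltr_norml => /andP[/andP[? ?] /andP[? ?]];
    apply/andP; split; apply/andP; split; lra.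
by move: ll; rewrite /l /l' (lexpos_near d _ (p - q') qq2) ?addbb.
Qed.

(** Chains with steps below [d] stand in for paths: they exist in every connected set,
    path-connected or not. *)
Definition reach (A : set (R * R)) d p q :=
  exists s, [/\ path (near2 d) p s, last p s = q & forall z, z \in p :: s -> A z].

(** In [crossings_grid], [crossings_opp] at both ends of the first path reverses the differences, at
    the cost of terms in the four end points only. *)
Lemma crossings_pair d p s q t : 0 < d ->
  path (near2 d) p s -> path (near2 d) q t ->
  far_apart (2 * d) (p :: s) (q :: t) ->
  crossings (fun z => z - q) p s (+) crossings (fun z => z - last q t) p s (+)
  (crossings (fun z => z - p) q t (+) crossings (fun z => z - last p s) q t) =
  lexpos (p - q) (+) lexpos (p - last q t) (+)
  (lexpos (last p s - q) (+) lexpos (last p s - last q t)).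
Proof.
move=> d0 ps qt far.
have near2W x y : near2 d x y -> near2 (2 * d) x y.
  by move=> /andP[a b]; apply/andP; split; lra.
have far1 x : x \in p :: s -> far_apart d [:: x] (q :: t).
  move=> xs a b; rewrite inE => /eqP-> bt.
  by apply: contra (far _ _ xs bt); exact: near2W.
rewrite -(crossings_opp d)//; last by apply: far1; rewrite inE eqxx.
rewrite -(crossings_opp d)//; last by apply: far1; exact: mem_last.
by rewrite -(crossings_grid d)// addbACA.
Qed.

(** Lets [ring] handle these sums, in the Boolean ring with addition [xorb]. *)
Lemma addb_xorb : addb = xorb.
Proof. by apply/funext => -[]; apply/funext => -[]. Qed.

Definition offdiag_sum (M : 'I_3 -> 'I_3 -> bool) :=
  let o0 := @Ordinal 3 0 isT in
  let o1 := @Ordinal 3 1 isT in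
  let o2 := @Ordinal 3 2 isT in
  M o0 o1 (+) M o1 o0 (+) (M o0 o2 (+) M o2 o0) (+) (M o1 o2 (+) M o2 o1).

(** Add the six relations: each [Na i], [Nb j], [ha j], [hb i] occurs twice and [c] six times. What
    survives besides the two sums is one unit from [h i j] and [h j i] for each of the three pairs,
    an odd total. *)
Lemma K33_parity (Na Nb : 'I_3 -> bool) (Ma Mb : 'I_3 -> 'I_3 -> bool)
    (c : bool) (ha hb : 'I_3 -> bool) (h : 'I_3 -> 'I_3 -> bool) :
  (forall i j, i != j -> h j i = ~~ h i j) ->
  (forall i j, i != j -> Na i (+) Ma i j (+) (Nb j (+) Mb j i) =
                         c (+) ha j (+) (hb i (+) h i j)) ->
  offdiag_sum Mb = ~~ offdiag_sum Ma.
Proof.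
move=> asym E; rewrite /offdiag_sum.
set o0 := Ordinal _; set o1 := Ordinal _; set o2 := Ordinal _.
have E01 := E o0 o1 isT; have E10 := E o1 o0 isT.
have E02 := E o0 o2 isT; have E20 := E o2 o0 isT.
have E12 := E o1 o2 isT; have E21 := E o2 o1 isT.
rewrite (asym o0 o1)// in E10; rewrite (asym o0 o2)// in E20.
rewrite (asym o1 o2)// in E21.
have := congr2 addb (congr2 addb (congr2 addb E01 E10) (congr2 addb E02 E20))
  (congr2 addb E12 E21).
rewrite !addb_xorb -!Bool.xorb_true_l => {E01 E10 E02 E20 E12 E21} E.
have F (x y : bool) : x = y -> xorb x y = false.
  by move=> ->; exact: Bool.xorb_nilpotent.
by apply: Bool.xorb_eq; apply: etrans (F _ _ E); ring.
Qed.

(* Only vertex-disjoint edges are required to stay apart. Writing W a for the sum,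
   over i != j, of the windings of the edge (a, i) around Q j, the relations of
   crossings_pair add up to W b = ~~ W a for any a != b, which is impossible for
   three values of a. *)
Lemma K33_not_planar d (P Q : 'I_3 -> R * R) (S : 'I_3 -> 'I_3 -> set (R * R)) :
  0 < d -> (forall a i, reach (S a i) d (P a) (Q i)) ->
  ~ (forall a b i j p q, a != b -> i != j -> S a i p -> S b j q ->
       ~~ near2 (2 * d) p q).
Proof.
move=> d0 edges far.
have [s sP] := choice (fun x : 'I_3 * 'I_3 => edges x.1 x.2).
pose N w a i := crossings (fun z => z - w) (P a) (s (a, i)).
pose W a := offdiag_sum (fun i j => N (Q j) a i).
have lastE a i : last (P a) (s (a, i)) = Q i by case: (sP (a, i)).
have WN a b : a != b -> W b = ~~ W a.
  move=> ab; apply: (@K33_parity (N (P b) a) (N (P a) b) _ _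
    (lexpos (P a - P b)) (fun j => lexpos (P a - Q j))
    (fun i => lexpos (Q i - P b)) (fun i j => lexpos (Q i - Q j))).
    move=> i j ij; apply: lexposN.
    (* [Q i] and [Q j] differ because they lie on edges kept apart, from vertex 0 to [Q i] and from
       another vertex [k] to [Q j]. *)
    have [k ki] : exists k : 'I_3, k != ord0 by exists (@Ordinal 3 1 isT).
    have := far ord0 k i j (Q i) (Q j); rewrite eq_sym => /(_ ki ij) h.
    case: (sP (ord0, i)) => [_ /= e1 m1]; case: (sP (k, j)) => [_ /= e2 m2].
    apply/eqP => e; move: h; rewrite e near2_refl ?mulr_gt0// => h.
    suff : false by [].
    apply: h.
      by apply: m1; rewrite -e -e1 mem_last.
    by apply: m2; rewrite -e2 mem_last.
  move=> i j ij; case: (sP (a, i)) => [pa /= ea ma].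
  case: (sP (b, j)) => [pb /= eb mb].
  have := crossings_pair _ _ _ _ _ d0 pa pb; rewrite ea eb; apply.
  by move=> p q /ma + /mb; exact: far.
have e01 := WN (@Ordinal 3 0 isT) (@Ordinal 3 1 isT) isT.
have e02 := WN (@Ordinal 3 0 isT) (@Ordinal 3 2 isT) isT.
have e12 := WN (@Ordinal 3 1 isT) (@Ordinal 3 2 isT) isT.
by move: e12; rewrite e01 e02; case: (W _).
Qed.
End Parity.

Arguments near2 {R} d p q.
Arguments reach {R} A d p q.

(** * Chains in plane sets *)

Section PlaneTopology.
Import Order.TTheory GRing.Theory Num.Theory.
Import numFieldNormedType.Exports.
Local Open Scope classical_set_scope.
Local Open Scope ring_scope.

(** The part of [A] where [P] holds is open and closed in [A]; the interiors of [A -> P] and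
    [A -> ~ P] witness this. *)
Lemma connected_locally_constant (T : topologicalType) (A : set T)
    (P : T -> Prop) (x y : T) :
  connected A -> A x -> A y -> P x ->
  (forall z, A z -> exists2 U, nbhs z U &
    forall t, A t -> U t -> P z <-> P t) ->
  P y.
Proof.
move=> Aconn Ax Ay Px loc.
suff : A `&` P = A by move=> e; rewrite -e in Ay; case: Ay.
apply: Aconn; first by exists x.
  exists (interior [set z | A z -> P z]); first exact: open_interior.
  apply/seteqP; split=> z [Az].
    move=> Pz; split=> //; have [U zU locU] := loc z Az.
    by apply: filterS zU => t Ut At; apply/(locU t At Ut).
  by move=> /interior_subset /(_ Az).
exists (~` interior [set z | A z -> ~ P z]).
  by apply: open_closedC; exact: open_interior.
apply/seteqP; split=> z [Az].
  by move=> Pz; split=> // /interior_subset /(_ Az); exact.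
move=> nPz; split=> //; apply: contrapT => nP; apply: nPz.
have [U zU locU] := loc z Az.
by apply: filterS zU => t Ut At Pt; apply: nP; apply/(locU t At Ut).
Qed.

Variable R : realType.
Implicit Types (A B K : set (R * R)) (p q : R * R) (d e : R).

Lemma ball_near2 p d q : ball p d q <-> near2 d p q.
Proof. by split=> [[a b]|/andP[a b]]; [apply/andP|]; split. Qed.

Lemma nbhs_near2 p d : 0 < d -> nbhs p [set q | near2 d p q].
Proof.
move=> d0; apply: filterS (nbhsx_ballx p d d0) => q; by move/ball_near2.
Qed.

Lemma near2_sym d p q : near2 d p q = near2 d q p.
Proof. by rewrite /near2 distrC (distrC p.2). Qed.

Lemma reach_refl A d p : A p -> reach A d p p.
Proof. by exists [::]; split=> // z; rewrite inE => /eqP->. Qed.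

Lemma reach_step A d p q r : reach A d p q -> A r -> near2 d q r ->
  reach A d p r.
Proof.
move=> [s [ps <- sA]] Ar qr; exists (rcons s r).
rewrite rcons_path ps qr last_rcons; split=> // z.
by rewrite -rcons_cons mem_rcons inE => /orP[/eqP->//|]; exact: sA.
Qed.

Lemma reach_trans A d p q r : reach A d p q -> reach A d q r ->
  reach A d p r.
Proof.
move=> [s [ps sq sA]] [t [pt tr tA]]; exists (s ++ t).
rewrite cat_path last_cat sq ps pt; split=> // z.
by rewrite -cat_cons mem_cat => /orP[/sA//|zt]; apply: tA; rewrite inE zt orbT.
Qed.

Lemma sub_reach A B d p q : A `<=` B -> reach A d p q -> reach B d p q.
Proof. by move=> AB [s [ps sq sA]]; exists s; split=> // z /sA/AB. Qed.

Lemma connected_reach A d p q : connected A -> 0 < d -> A p -> A q ->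
  reach A d p q.
Proof.
move=> Aconn d0 Ap Aq.
apply: (connected_locally_constant _ A (reach A d p) p q) => //.
  exact: reach_refl.
move=> z Az; exists [set t | near2 d z t]; first exact: nbhs_near2.
by move=> t At zt; split=> h; apply: reach_step h _ _; rewrite // near2_sym.
Qed.

Definition clear K e := [set p | forall q, K q -> ~~ near2 e p q].

Lemma clearW K e e' : e' <= e -> clear K e `<=` clear K e'.
Proof.
move=> ee p pK q /pK; apply: contra => /andP[a b].
by apply/andP; split; apply: lt_le_trans ee.
Qed.

Lemma clear_near K e e' p q : clear K (e + e') p -> near2 e p q -> clear K e' q.
Proof.
move=> pK /ball_near2 pq r /pK; apply: contra => /ball_near2 qr.
by apply/ball_near2; apply: ball_triangle qr.
Qed.

Lemma closed_clear K p : closed K -> ~ K p -> exists2 e, 0 < e & clear K e p.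
Proof.
move=> Kcl nKp.
have /nbhs_ballP[e /= e0 eK] : nbhs p (~` K).
  by apply: open_nbhs_nbhs; split => //; exact: closed_openC.
exists e => // q Kq; apply/negP => /ball_near2 /eK; exact.
Qed.

(** Half the clearance at a point works on a neighbourhood of it; compactness in near-covering form
    then gives one radius for all of [A]. *)
Lemma compact_clear A K : compact A -> closed K -> A `&` K = set0 ->
  exists2 e, 0 < e & A `<=` clear K e.
Proof.
move=> /compact_near_coveringP Acp Kcl AK.
have : \forall e \near 0^'+, A `<=` clear K e.
  apply: (Acp _ _ (fun e p => clear K e p)) => x Ax.
  have nKx : ~ K x by move=> Kx; have : set0 x by rewrite -AK.
  have [e e0 ex] := closed_clear K x Kcl nKx.
  have e20 : 0 < e / 2 by apply: divr_gt0.
  exists ([set t | near2 (e / 2) x t], [set d | d < e / 2]).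
    by split; [exact: nbhs_near2 | exact: nbhs_right_lt].
  move=> [t d] [/= xt de]; apply: (@clearW K (e / 2)); first exact: ltW.
  by apply: clear_near xt; rewrite -splitr.
move=> H; near (0 : R)^'+ => e; exists e => //.
by near: e.
Unshelve. all: by end_near.
Qed.

(** The square is a union of segments issuing from its centre. *)
Lemma near2_connected p d : 0 < d -> connected [set q | near2 d p q].
Proof.
move=> d0.
pose f q (t : R) := (p.1 + t * (q.1 - p.1), p.2 + t * (q.2 - p.2)).
have -> : [set q | near2 d p q] =
    \bigcup_(q in [set q | near2 d p q]) (f q @` `[0, 1]).
  apply/seteqP; split=> q.
    move=> pq; exists q => //; exists 1; first by rewrite /= in_itv /= ler01 lexx.
    by rewrite /f !mul1r !(addrC _ (_ - _)) !subrK; case: q pq.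
  move=> [r pr [t]] /=; rewrite in_itv /= => /andP[t0 t1] <-.
  have scale (x : R) : `|x| < d -> `|t * x| < d.
    move=> xd; rewrite normrM (ger0_norm t0); apply: le_lt_trans xd.
    by rewrite ler_piMl.
  move: pr => /andP[/= a b]; rewrite /near2 /=.
  by rewrite !opprD !addNKr !normrN !scale // distrC.
apply: bigcup_connected.
  exists p => q _; exists 0; first by rewrite /= in_itv /= ler01 lexx.
  by rewrite /f !mul0r !addr0; case: (p).
move=> q _; apply: connected_continuous_connected.
  exact: segment_connected.
apply: continuous_subspaceT => t.
have line (a b : R) : a + x * b @[x --> t] --> a + t * b.
  by apply: cvgD; [exact: cvg_cst | apply: cvgM; [exact: cvg_id | exact: cvg_cst]].
exact: (cvg_pair (G := nbhs (f q t).1) (H := nbhs (f q t).2)).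
Qed.

(** [A] may come arbitrarily close to [K], yet one radius, independent of the step [d], serves the
    given [p] and [q]: whether such a radius exists is locally constant in [q]. *)
Lemma connected_reach_clear A K p q : connected A -> closed K -> A `&` K = set0 ->
  A p -> A q ->
  exists2 e, 0 < e & forall d, 0 < d -> reach (clear K e) d p q.
Proof.
move=> Aconn Kcl AK Ap Aq.
have nAK t : A t -> ~ K t by move=> At Kt; have : set0 t by rewrite -AK.
pose P q := exists2 e, 0 < e & forall d, 0 < d -> reach (clear K e) d p q.
apply: (connected_locally_constant _ A P p q) => //.
  have [e e0 ep] := closed_clear K p Kcl (nAK _ Ap).
  by exists e => // d d0; exact: reach_refl.
move=> z Az; have [e e0 ez] := closed_clear K z Kcl (nAK _ Az).
have e20 : 0 < e / 2 by apply: divr_gt0.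
exists [set t | near2 (e / 2) z t]; first exact: nbhs_near2.
have sub : [set t | near2 (e / 2) z t] `<=` clear K (e / 2).
  by move=> t; apply: clear_near; rewrite -splitr.
have zz : near2 (e / 2) z z by exact: near2_refl.
move=> t At zt; split=> -[e' e'0 h]; exists (Num.min e' (e / 2));
  rewrite ?lt_min ?e'0// => d d0.
  apply: (@reach_trans _ _ _ z).
    by apply: sub_reach (h d d0); apply: clearW; rewrite ge_min lexx.
  apply: sub_reach (connected_reach _ d _ _ (near2_connected z (e / 2) e20) d0 _ _) => //.
  by apply: subset_trans sub _; apply: clearW; rewrite ge_min lexx orbT.
apply: (@reach_trans _ _ _ t).
  by apply: sub_reach (h d d0); apply: clearW; rewrite ge_min lexx.
apply: sub_reach (connected_reach _ d _ _ (near2_connected z (e / 2) e20) d0 _ _) => //.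
by apply: subset_trans sub _; apply: clearW; rewrite ge_min lexx orbT.
Qed.

Lemma common_radius (I : finType) (P : I -> R -> Prop) :
  (forall i e e', e' <= e -> P i e -> P i e') ->
  (forall i, exists2 e, 0 < e & P i e) -> exists2 e, 0 < e & forall i, P i e.
Proof.
move=> mono /(_ _)/cid2-/all_sig2[f f0 fP].
exists (\big[Num.min/1]_i f i); first by apply: lt_bigmin.
by move=> i; apply: mono (fP i); exact: bigmin_le_cond.
Qed.

(* The chains in clear K e provide the third vertex of K_{3,3}, placed in F. As
   v i need not be accessible from F, the last bit of its edge to v i runs in a
   small disc around v i, where it may cross A i and B i: these edges share the
   vertex v i with it. *)
Lemma no_theta (A B : 'I_3 -> set (R * R)) (F : set (R * R))
    (a b : R * R) (v : 'I_3 -> R * R) :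
  (forall i, compact (A i)) -> (forall i, connected (A i)) ->
  (forall i, compact (B i)) -> (forall i, connected (B i)) ->
  (forall i, A i a /\ A i (v i)) -> (forall i, B i b /\ B i (v i)) ->
  (forall i j, i != j -> A i `&` B j = set0) ->
  connected F -> (forall i, F `&` A i = set0) -> (forall i, F `&` B i = set0) ->
  ~ (forall i, closure F (v i)).
Proof.
move=> Acp Acn Bcp Bcn Aab Bab AB Fcn FA FB vF.
have cl (C : set (R * R)) : compact C -> closed C.
  by apply: compact_closed; exact: norm_hausdorff.
have dis (C D : set (R * R)) t : C `&` D = set0 -> C t -> ~ D t.
  by move=> CD Ct Dt; have : set0 t by rewrite -CD.
(* [e1] separates [A i] from [B j], [e2] separates [v j] from the edges of index [i], and [e3]
   separates chains in [F] from all edges. On the diagonal nothing is claimed and 1 is a dummy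
   radius. *)
have [e1 e10 ABe] : exists2 e, 0 < e & forall ij : 'I_3 * 'I_3, ij.1 != ij.2 ->
    A ij.1 `<=` clear (B ij.2) e.
  apply: common_radius => [ij e e' ee h /h /subset_trans|[i j] /=].
    by apply; exact: clearW.
  have [_|ij] := eqVneq i j; first by exists 1.
  by have [e e0 ?] := compact_clear _ _ (Acp i) (cl _ (Bcp j)) (AB i j ij); exists e.
have [e2 e20 ve] : exists2 e, 0 < e & forall ij : 'I_3 * 'I_3, ij.1 != ij.2 ->
    clear (A ij.1 `|` B ij.1) e (v ij.2).
  apply: common_radius => [ij e e' ee h /h|[i j] /=]; first exact: clearW.
  have [_|ij] := eqVneq i j; first by exists 1.
  have [||e e0 ?] := closed_clear (A i `|` B i) (v j); last by exists e.
    by apply: closedU; exact: cl.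
  move=> [] vC.
    by apply: dis vC (Bab j).2; exact: AB.
  by apply: dis vC; [apply: AB; rewrite eq_sym | exact: (Aab j).2].
have e220 : 0 < e2 / 2 by apply: divr_gt0.
(* The closure hypothesis enters here: [x i] is a point of [F] from which [v i] is reached inside a
   square still [e2 / 2] away from the edges of other indices. *)
have /(_ _)/cid-/all_sig[x xP] : forall i, exists x, F x /\ near2 (e2 / 2) (v i) x.
  by move=> i; have [y []] := vF i _ (nbhs_near2 (v i) _ e220); exists y.
pose K := \bigcup_i (A i `|` B i).
have Kcl : closed K.
  apply: closed_bigcup; first exact: finite_finset.
  by move=> i _; apply: closedU; exact: cl.
have FK : F `&` K = set0.
  apply/seteqP; split=> // t [Ft [i _ []]]; exact: (dis F).
have [e3 e30 xe] : exists2 e, 0 < e & forall i : 'I_3, 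
    forall d, 0 < d -> reach (clear K e) d (x ord0) (x i).
  apply: common_radius => [i e e' ee h d /h|i].
    by apply: sub_reach; exact: clearW.
  exact: connected_reach_clear Fcn Kcl FK (xP _).1 (xP i).1.
pose e := Num.min e1 (Num.min (e2 / 2) e3).
have e0 : 0 < e by rewrite !lt_min e10 e220.
pose C i := clear K e3 `|` [set t | near2 (e2 / 2) (v i) t].
pose S (k i : 'I_3) := nth set0 [:: A i; B i; C i] k.
have Cclear i j : i != j -> C j `<=` clear (A i `|` B i) e.
  move=> ij t [tK|vt].
    apply: (@clearW _ e3); first by rewrite !ge_min lexx !orbT.
    by move=> r rAB; apply: tK; exists i.
  apply: (@clearW _ (e2 / 2)); first by rewrite !ge_min lexx !orbT.
  by apply: clear_near vt; rewrite -splitr; exact: ve (i, j) ij.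
(* [K33_not_planar] wants distances of twice the step, hence steps of [e / 2]. *)
have e20' : 0 < e / 2 by apply: divr_gt0.
apply: (@K33_not_planar R (e / 2) (fun k : 'I_3 => nth a [:: a; b; x ord0] k) v S) => //.
  move=> [[|[|[|//]]] ?] i; rewrite /S /=.
  - by apply: connected_reach => //; [exact: (Aab i).1 | exact: (Aab i).2].
  - by apply: connected_reach => //; [exact: (Bab i).1 | exact: (Bab i).2].
  apply: (@reach_trans _ _ _ (x i)).
    by apply: sub_reach (xe i _ e20'); left.
  apply: (@sub_reach [set t | near2 (e2 / 2) (v i) t]); first by right.
  apply: connected_reach => //; first exact: near2_connected.
    exact: (xP i).2.
  exact: near2_refl.
have -> : 2 * (e / 2) = e by rewrite mulrC divfK ?pnatr_eq0.
have AC i j p q : i != j -> A i p -> C j q -> ~~ near2 e p q.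
  by move=> ij Ap /(Cclear i j ij); rewrite near2_sym; apply; left.
have BC i j p q : i != j -> B i p -> C j q -> ~~ near2 e p q.
  by move=> ij Bp /(Cclear i j ij); rewrite near2_sym; apply; right.
have ABf i j p q : i != j -> A i p -> B j q -> ~~ near2 e p q.
  move=> ij Ap; apply: (@clearW _ e1); first by rewrite !ge_min lexx.
  exact: ABe (i, j) ij _ Ap.
move=> [[|[|[|//]]] ?] [[|[|[|//]]] ?] i j p q // _ ij; rewrite /S /=.
- exact: ABf.
- exact: AC.
- by move=> Bp Aq; rewrite near2_sym; apply: (ABf j i); rewrite // eq_sym.
- exact: BC.
- by move=> Cp Aq; rewrite near2_sym; apply: (AC j i); rewrite // eq_sym.
- by move=> Cp Bq; rewrite near2_sym; apply: (BC j i); rewrite // eq_sym.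
Qed.

End PlaneTopology.
(** * Drawings and the subgroup lattice *)

Section Drawing.
Import Order.TTheory GRing.Theory Num.Theory.
Import numFieldNormedType.Exports.
Local Open Scope classical_set_scope.
Local Open Scope ring_scope.
Variables (R : realType) (V : Type) (adj : V -> V -> Prop).
Variable e : planar_embedding R adj.

Definition subdrawing (P : set V) : set (R * R) :=
  (pe_pos e @` P) `|`
  [set p | exists u v t,
    [/\ adj u v, P u, P v, unit_interval (t : R) & p = pe_arc e u v t]].

Lemma sub_subdrawing (P Q : set V) : P `<=` Q -> subdrawing P `<=` subdrawing Q.
Proof.
move=> PQ p [[u /PQ Qu <-]|[u [v [t [uv /PQ Pu /PQ Pv It ->]]]]].
  by left; exists u.
by right; exists u, v, t; split.
Qed.

Lemma subdrawing_drawing P : subdrawing P `<=` drawing e.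
Proof.
move=> p [[u _ <-]|[u [v [t [uv _ _ It ->]]]]]; first by left; exists u.
by right; exists u, v, t.
Qed.

(** Arc ends are counted as vertices, since the disjointness axioms of an embedding concern open
    arcs. *)
Lemma subdrawingE P p : subdrawing P p ->
  (exists2 u, P u & p = pe_pos e u) \/
  exists u v t, [/\ adj u v, P u, P v, open_unit_interval (t : R) & p = pe_arc e u v t].
Proof.
case=> [[u Pu <-]|[u [v [t [uv Pu Pv /andP[t0 t1] ->]]]]]; first by left; exists u.
move: t0; rewrite le_eqVlt => /orP[/eqP<-|t0].
  by left; exists u => //; rewrite pe_arc0.
move: t1; rewrite le_eqVlt => /orP[/eqP->|t1].
  by left; exists v => //; rewrite pe_arc1.
by right; exists u, v, t; split=> //; apply/andP; split.
Qed.

(** Edges spanned by disjoint vertex sets differ in either orientation, so every kind of meeting is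
    excluded by an axiom of the embedding. *)
Lemma subdrawing_disjoint P Q : P `&` Q = set0 ->
  subdrawing P `&` subdrawing Q = set0.
Proof.
move=> PQ; have dis u : P u -> Q u -> False.
  by move=> Pu Qu; have : set0 u by rewrite -PQ.
apply/seteqP; split=> // p [/subdrawingE + /subdrawingE].
move=> [[u Pu ->]|[u [v [t [uv Pu Pv It ->]]]]].
  move=> [[w Qw E]|[u' [v' [t' [uv' _ _ It' E]]]]].
    by apply: dis Qw; rewrite -(pe_pos_inj E).
  by have := pe_arc_vertex (p := e) (w := u) uv' It'; rewrite -E.
move=> [[w Qw E]|[u' [v' [t' [uv' Qu Qv It' E]]]]].
  by have := pe_arc_vertex (p := e) (w := w) uv It.
apply: (pe_arc_disj uv uv' _ It It' E) => -[[uu _]|[uu _]].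
  by apply: dis Qu; rewrite -uu.
by apply: dis Qv; rewrite -uu.
Qed.

(** A compact connected set replaces a path, in the form in which [no_theta] takes its edges. *)
Definition joined (P : set V) u v := exists C : set (R * R),
  [/\ compact C, connected C, C (pe_pos e u), C (pe_pos e v) & C `<=` subdrawing P].

Lemma joined_refl (P : set V) u : P u -> joined P u u.
Proof.
move=> Pu; exists [set pe_pos e u]; split=> //.
- exact: compact_set1.
- exact: connected1.
- by move=> _ ->; left; exists u.
Qed.

Lemma unit_intervalE : @unit_interval R = `[0, 1]%classic.
Proof. by apply/seteqP; split=> t; rewrite /= in_itv. Qed.

Lemma joined_step (P : set V) u v w : adj u v -> P u -> P v -> joined P v w ->
  joined P u w.
Proof.
move=> uv Pu Pv [C [Ccp Ccn Cv Cw CP]].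
have contA := @pe_arc_cont _ _ _ e _ _ uv; rewrite unit_intervalE in contA.
exists ((pe_arc e u v @` `[0, 1]) `|` C); split.
- apply: compactU => //; apply: continuous_compact => //; exact: segment_compact.
- apply: connectedU => //; last first.
    by apply: connected_continuous_connected => //; exact: segment_connected.
  exists (pe_pos e v); split => //; exists 1; last exact: pe_arc1.
  by rewrite /= in_itv /= ler01 lexx.
- left; exists 0; last exact: pe_arc0.
  by rewrite /= in_itv /= ler01 lexx.
- by right.
move=> p [[t]|/CP//]; rewrite -unit_intervalE => It <-.
by right; exists u, v, t.
Qed.

Lemma sub_joined (P Q : set V) u v : P `<=` Q -> joined P u v -> joined Q u v.
Proof.
move=> PQ [C [? ? ? ? CP]]; exists C; split=> //.
exact: subset_trans CP (sub_subdrawing _ _ PQ).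
Qed.

End Drawing.

(** A counterexample has an [r]-successor that is again one; choice iterates this into an infinite
    chain. *)
Lemma no_chain_ind (T : Type) (r : T -> T -> Prop) :
  ~ (exists c : nat -> T, forall n, r (c n) (c n.+1)) ->
  forall Q : T -> Prop, (forall x, (forall y, r x y -> Q y) -> Q x) ->
  forall x, Q x.
Proof.
move=> nochain Q IH x; apply: contrapT => nQx; apply: nochain.
have step (y : {y | ~ Q y}) : exists z : {y | ~ Q y}, r (sval y) (sval z).
  case: y => y nQy; apply: contrapT => nz; apply: (nQy); apply: IH => z yz.
  by apply: contrapT => nQz; apply: nz; exists (exist _ z nQz).
have [f fP] := choice step.
exists (fun n => sval (iter n f (exist _ x nQx))) => n; exact: fP.
Qed.

(** * Chain conditions, paths in subgroup intervals and antichains *)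

Section Subgroups.
Local Open Scope classical_set_scope.
Variable G : AbsGroup.
Implicit Types H K L : subgroup G.

Definition sgle H K := proj1_sig H `<=` proj1_sig K.
Definition sglt H K := sgle H K /\ proj1_sig H <> proj1_sig K.

Lemma subgroup_eq H K : proj1_sig H = proj1_sig K -> H = K.
Proof. by case: H K => [H hH] [K hK] /= E; exact: eq_exist. Qed.

Lemma ACC_ind : ACC_subgroups G -> forall Q : subgroup G -> Prop,
  (forall H, (forall K, sglt H K -> Q K) -> Q H) -> forall H, Q H.
Proof.
move=> acc; apply: no_chain_ind => -[c cP].
have [N NP] := acc c (fun n => (cP n).1).
by apply: (cP N).2; rewrite (NP N.+1 (leqnSn N)).
Qed.

Lemma DCC_ind : DCC_subgroups G -> forall Q : subgroup G -> Prop,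
  (forall H, (forall K, sglt K H -> Q K) -> Q H) -> forall H, Q H.
Proof.
move=> dcc; apply: no_chain_ind => -[c cP].
have [N NP] := dcc c (fun n => (cP n).1).
by apply: (cP N).2; rewrite (NP N.+1 (leqnSn N)).
Qed.

(** If [H] is not maximal in [K], some [L] lies strictly between, and the descent continues from
    [L]. *)
Lemma DCC_atom : DCC_subgroups G -> forall H K, sglt H K ->
  exists2 L, maximal_in H L & sgle L K.
Proof.
move=> dcc H; apply: (DCC_ind dcc) => K IH [HK neHK].
have [HmK|nmax] := pselect (maximal_in H K); first by exists K.
have [L [HL LK LH LneK]] : exists L, [/\ sgle H L, sgle L K,
    proj1_sig L <> proj1_sig H & proj1_sig L <> proj1_sig K].
  apply: contrapT => nL; apply: nmax; split=> //; split=> // L HL LK.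
  have [->|LH] := pselect (proj1_sig L = proj1_sig H); first by left.
  have [->|LneK] := pselect (proj1_sig L = proj1_sig K); first by right.
  by exfalso; apply: nL; exists L.
have [M HM ML] := IH L (conj LK LneK) (conj HL (nesym LH)).
by exists M => // x /ML /LK.
Qed.

(** Climb from [H] by atoms below [K]; the ascending chain condition ends the climb. *)
Lemma interval_joined (R : realType)
    (e : planar_embedding R (@subgroup_adj G)) H K :
  ACC_subgroups G -> DCC_subgroups G -> sgle H K ->
  joined R _ _ e [set L | sgle H L /\ sgle L K] H K.
Proof.
move=> acc dcc; move: H; apply: (ACC_ind acc) => H IH HK.
have [E|neHK] := pselect (proj1_sig H = proj1_sig K).
  by rewrite (subgroup_eq _ _ E); apply: joined_refl; split.
have [L HL LK] := DCC_atom dcc _ _ (conj HK neHK).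
have HsL : sgle H L by case: HL.
apply: (joined_step _ _ _ e _ H L); [by left | by split | by split |].
apply: sub_joined (IH L _ LK); last by case: HL => ? [].
by move=> M [LM MK]; split=> // x /HsL /LM.
Qed.

(** The group axioms are left-sided; cancellation yields the right-sided laws. *)
Lemma gmul_injl (x y z : G) : gmul x y = gmul x z -> y = z.
Proof. by move=> /(congr1 (gmul (ginv x))); rewrite !gmulA gmulV !gmul1. Qed.

Lemma gmulg1 (x : G) : gmul x (gone G) = x.
Proof. by apply: (@gmul_injl (ginv x)); rewrite gmulA gmulV gmul1. Qed.

Lemma gmulgV (x : G) : gmul x (ginv x) = gone G.
Proof. by apply: (@gmul_injl (ginv x)); rewrite gmulA gmulV gmul1 gmulg1. Qed.

Lemma ginv1 : ginv (gone G) = gone G.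
Proof. by rewrite -[LHS]gmulg1 gmulV. Qed.

Lemma is_subgroup1 : is_subgroup [set gone G].
Proof.
split=> //; split=> [x y|x] -> //; first by move=> ->; rewrite /= gmul1.
by rewrite /= ginv1.
Qed.

Lemma is_subgroupT : is_subgroup [set: G].
Proof. by []. Qed.

Definition no_antichain3 := forall M : 'I_3 -> subgroup G,
  exists i j, i != j /\ sgle (M i) (M j).

Lemma outer_planar_no_antichain3 (R : realType) : outer_planar_group R G ->
  ACC_subgroups G -> DCC_subgroups G -> no_antichain3.
Proof.
move=> [e [F [[x [Dx ->]] [_ Fcl]]]] acc dcc M; apply: contrapT => nM.
pose T := exist _ _ is_subgroup1; pose U := exist _ _ is_subgroupT.
have TM i : sgle T (M i) by move=> _ ->; case: (svalP (M i)).
have MU i : sgle (M i) U by [].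
have [A AP] := choice (fun i => interval_joined R e _ _ acc dcc (TM i)).
have [B BP] := choice (fun i => interval_joined R e _ _ acc dcc (MU i)).
set comp := connected_component _ _ in Fcl.
have compD (C : set (R * R)%type) P : C `<=` subdrawing R _ _ e P -> comp `&` C = set0.
  move=> CP; apply/seteqP; split=> // p [+ /CP/subdrawing_drawing].
  by move=> /connected_component_sub.
apply: (@no_theta R A B comp (pe_pos e T) (pe_pos e U) (fun i => pe_pos e (M i))).
- by move=> i; case: (AP i).
- by move=> i; case: (AP i).
- by move=> i; case: (BP i).
- by move=> i; case: (BP i).
- by move=> i; case: (AP i).
- by move=> i; case: (BP i).
- move=> i j ij; case: (AP i) (BP j) => [_ _ _ _ AD] [_ _ _ _ BD].
  (* A common vertex [L] would give [M j <= L <= M i]. *)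
  have dis : [set L | sgle T L /\ sgle L (M i)] `&`
             [set L | sgle (M j) L /\ sgle L U] = set0.
    apply/seteqP; split=> // L [[_ LM] [ML _]]; apply: nM; exists j, i.
    by split; [rewrite eq_sym | move=> y /ML /LM].
  apply/seteqP; split=> // p [/AD Ap /BD Bp].
  by rewrite -(subdrawing_disjoint R _ _ e _ _ dis).
- exact: component_connected.
- by move=> i; case: (AP i) => [_ _ _ _]; exact: compD.
- by move=> i; case: (BP i) => [_ _ _ _]; exact: compD.
- by move=> i; exact: Fcl.
Qed.

End Subgroups.

Arguments sgle {G} H K.
Arguments sglt {G} H K.

(** * Groups whose subgroup lattice has width at most two *)

Section Cyclic.
Local Open Scope classical_set_scope.
Variable G : AbsGroup.
Implicit Types (x y z : G) (H K L : subgroup G).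

Definition gpow x n := iter n (gmul x) (gone G).

Lemma gpowD x m n : gpow x (m + n) = gmul (gpow x m) (gpow x n).
Proof. by elim: m => [|m IH] /=; rewrite ?gmul1// IH gmulA. Qed.

Lemma gpowM x m n : gpow x (m * n) = gpow (gpow x m) n.
Proof. by elim: n => [|n IH]; rewrite ?muln0// mulnS gpowD IH. Qed.

Lemma gpow_eq x i j : i <= j -> gpow x i = gpow x j -> gpow x (j - i) = gone G.
Proof.
move=> ij E; apply: (@gmul_injl G (gpow x i)).
by rewrite -gpowD subnKC// -E gmulg1.
Qed.

(* y = x ^ (m - n): integer exponents are encoded as differences. *)
Definition cycle_set x : set G :=
  [set y | exists m n, gmul y (gpow x n) = gpow x m].

Lemma is_subgroup_cycle x : is_subgroup (cycle_set x).
Proof.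
split; first by exists 0, 0; rewrite /= gmul1.
split=> [y z [m [n ym]] [p [q zp]]|y [m [n ym]]]; last first.
  by exists n, m; rewrite -ym gmulA gmulV gmul1.
exists (m + p), (q + n).
by rewrite gpowD -gmulA (gmulA z) zp -gpowD addnC gpowD gmulA ym -gpowD.
Qed.

Definition cycle x : subgroup G := exist _ _ (is_subgroup_cycle x).

Lemma cycle_id x : sval (cycle x) x.
Proof. by exists 1, 0; rewrite /= !gmulg1. Qed.

Lemma cycle_le x H : sgle (cycle x) H <-> sval H x.
Proof.
split=> [|Hx y [m [n ym]]]; first by apply; exact: cycle_id.
have [H1 [HM HV]] := svalP H.
have Hp k : sval H (gpow x k) by elim: k => [|k IH] //=; apply: HM.
have -> : y = gmul (gpow x m) (ginv (gpow x n)).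
  by rewrite -ym -gmulA gmulgV gmulg1.
by apply: HM => //; apply: HV.
Qed.

(** A cycle that is not maximal is replaced by a larger one. The induction is over all subgroups, so
    the claim is first restated for any [H] that equals a cycle. *)
Lemma ACC_max_cycle : ACC_subgroups G -> forall x, exists z,
  sval (cycle z) x /\ forall w, sval (cycle w) z -> sval (cycle z) w.
Proof.
move=> acc x.
suff : forall H x, sval H = sval (cycle x) -> exists z,
    sval (cycle z) x /\ forall w, sval (cycle w) z -> sval (cycle z) w.
  by move=> /(_ (cycle x)); apply.
clear x; apply: (ACC_ind G acc) => H IH x Hx.
have [mx|nmx] := pselect (forall w, sval (cycle w) x -> sval (cycle x) w).
  by exists x; split=> //; exact: cycle_id.
have [w wx nxw] : exists2 w, sval (cycle w) x & ~ sval (cycle x) w.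
  apply: contrapT => nw; apply: nmx => w wx.
  by apply: contrapT => nxw; apply: nw; exists w.
have lt : sglt H (cycle w).
  split; rewrite /sgle Hx; first by apply/cycle_le.
  by move=> E; apply: nxw; rewrite E; exact: cycle_id.
have [z [zw zmax]] := IH _ lt w erefl.
by exists z; split=> //; move/cycle_le: zw; exact.
Qed.

Lemma no_antichain3_cyclic : ACC_subgroups G -> no_antichain3 G ->
  exists x, forall y, sval (cycle x) y.
Proof.
move=> acc wid; apply: contrapT => ncyc.
have mem_trans a b c : sval (cycle a) b -> sval (cycle b) c -> sval (cycle a) c.
  by move=> /cycle_le ab; exact: ab.
have maxc := ACC_max_cycle acc.
(* Any maximal cycle may start; the identity only supplies an element. *)
have [z1 [_ max1]] := maxc (gone G).
have [y nz1y] : exists y, ~ sval (cycle z1) y.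
  apply: contrapT => ny; apply: ncyc; exists z1 => y.
  by apply: contrapT => nz; apply: ny; exists y.
have [z2 [z2y max2]] := maxc y.
have n12 : ~ sval (cycle z1) z2 by move=> /mem_trans/(_ z2y).
have n21 : ~ sval (cycle z2) z1 by move=> /max1.
have [z3 [z3m max3]] := maxc (gmul z1 z2).
(* As for a union of two proper subgroups, [z1 z2] lies in neither cycle, so a maximal cycle around
   it is a third incomparable one. *)
have n1 : ~ sval (cycle z1) (gmul z1 z2).
  move=> h; apply: n12; have [_ [hM hV]] := svalP (cycle z1).
  have := hM _ _ (hV _ (cycle_id z1)) h.
  by rewrite gmulA gmulV gmul1.
have n2 : ~ sval (cycle z2) (gmul z1 z2).
  move=> h; apply: n21; have [_ [hM hV]] := svalP (cycle z2).
  have := hM _ _ h (hV _ (cycle_id z2)).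
  by rewrite -gmulA gmulgV gmulg1.
have n13 : ~ sval (cycle z1) z3 by move=> /mem_trans/(_ z3m).
have n23 : ~ sval (cycle z2) z3 by move=> /mem_trans/(_ z3m).
have n31 : ~ sval (cycle z3) z1 by move=> /max1.
have n32 : ~ sval (cycle z3) z2 by move=> /max2.
have [i [j []]] := wid (fun i : 'I_3 => cycle (nth z1 [:: z1; z2; z3] i)).
by case: i => -[|[|[|//]]] ?; case: j => -[|[|[|//]]] ? // _ /cycle_le.
Qed.

(* N = 0 when x has infinite order. *)
Lemma gpow_annihilator x : exists N, forall k, gpow x k = gone G <-> N %| k.
Proof.
have [[k k0 xk]|tors] := pselect (exists2 k, 0 < k & gpow x k = gone G); last first.
  exists 0 => k; rewrite dvd0n; split=> [xk|/eqP->//].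
  by rewrite -leqn0 leqNgt; apply/negP => k0; apply: tors; exists k.
have ex : exists k, (0 < k) && `[< gpow x k = gone G >].
  by exists k; rewrite k0; apply/asboolP.
have /andP[N0 /asboolP xN] := xchooseP ex.
case: (ex_minnP ex) => {k k0 xk N0 xN} N /andP[N0 /asboolP xN] Nmin.
have one n : gpow (gone G) n = gone G by elim: n => //= n ->; rewrite gmul1.
exists N => k; split=> [xk|/dvdnP[q ->]]; last by rewrite mulnC gpowM xN one.
apply/negPn; rewrite /dvdn -lt0n; apply/negP => r0.
have : N <= k %% N.
  apply: Nmin; rewrite r0; apply/asboolP.
  by move: xk; rewrite {1}(divn_eq k N) gpowD mulnC gpowM xN one gmul1.
by rewrite leqNgt ltn_mod N0.
Qed.

(** Membership gives [a + b n = b m] modulo [N], hence modulo [b]. The two cases reflect truncated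
    subtraction, and [N = 0] is covered. *)
Lemma cycle_dvd x N a b : (forall k, gpow x k = gone G <-> N %| k) ->
  b %| N -> sval (cycle (gpow x b)) (gpow x a) -> b %| a.
Proof.
move=> ann bN [m [n]]; rewrite -!gpowM -gpowD => E.
have [le|/ltnW le] := leqP (a + b * n) (b * m).
  have /ann/(dvdn_trans bN) := gpow_eq _ _ _ le E.
  rewrite dvdn_subr ?dvdn_mulr// => h.
  by move: h; rewrite dvdn_addl ?dvdn_mulr.
have /ann/(dvdn_trans bN) := gpow_eq _ _ _ le (esym E).
by rewrite dvdn_subl ?dvdn_mulr// dvdn_addl ?dvdn_mulr.
Qed.

Definition no_divisor_antichain3 N := forall d : 'I_3 -> nat,
  (forall i, d i %| N) -> exists i j, i != j /\ d i %| d j.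

(** Inclusion of cycles reverses divisibility of exponents, so the two indices are swapped. *)
Lemma no_antichain3_divisors x N : (forall k, gpow x k = gone G <-> N %| k) ->
  no_antichain3 G -> no_divisor_antichain3 N.
Proof.
move=> ann wid d dN; have [i [j [ij]]] := wid (fun i => cycle (gpow x (d i))).
move=> /cycle_le h; exists j, i; split; first by rewrite eq_sym.
exact: cycle_dvd ann (dN j) h.
Qed.

Lemma cycle_iso_Zn x N : 0 < N -> (forall k, gpow x k = gone G <-> N %| k) ->
  (forall y, sval (cycle x) y) -> iso_Zn G N.
Proof.
move=> N0 ann gen; split=> //.
have xmod k : gpow x (k %% N) = gpow x k.
  rewrite {2}(divn_eq k N) gpowD (ann (_ * _)).2 ?gmul1//.
  exact: dvdn_mull.
have /choice[f fP] y : exists k, k < N /\ gpow x k = y.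
  (* The exponent [m - n] is made non-negative as [m + n (N - 1)]. *)
  have [m [n ym]] := gen y; exists ((m + n * N.-1) %% N).
  rewrite ltn_mod N0; split=> //.
  rewrite xmod gpowD -ym -gmulA -gpowD -mulnS prednK// (ann _).2 ?gmulg1//.
  exact: dvdn_mull.
have inj i j : i < N -> j < N -> gpow x i = gpow x j -> i = j.
  wlog ij : i j / i <= j.
    by move=> h iN jN E; case/orP: (leq_total i j) => l; [|symmetry]; apply: h.
  move=> iN jN /(gpow_eq _ _ _ ij)/ann/dvdn_leq h.
  by apply/eqP; rewrite eqn_leq ij leqNgt -subn_gt0; apply/negP => /h; lia.
exists f; split=> [y z E|]; first by rewrite -(fP y).2 -(fP z).2 E.
split=> [k|y z].
  split=> [kN|[y <-]]; last by case: (fP y).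
  exists (gpow x k); apply: inj => //; first by case: (fP (gpow x k)).
  by case: (fP (gpow x k)).
apply: inj; first by case: (fP (gmul y z)).
  by rewrite ltn_mod.
by rewrite (fP _).2 xmod gpowD (fP y).2 (fP z).2.
Qed.

Lemma iso_Zn_finite N : iso_Zn G N -> finite_group G.
Proof.
move=> [_ [f [finj [fN _]]]]; rewrite /finite_group.
have -> : [set: G] = f @^-1` `I_N.
  by apply/seteqP; split=> // y _; apply/fN; exists y.
by apply: finite_preimage; [move=> y z _ _; exact: finj | exact: finite_II].
Qed.

End Cyclic.

(** * Integers without three pairwise incomparable divisors *)

Lemma no_divisor_antichain3_gt0 N : no_divisor_antichain3 N -> 0 < N.
Proof.
case: N => // h.
(* Everything divides 0, so 2, 3, 5 is an antichain of its divisors; this rules out infinite cyclic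
   groups. *)
have [i [j []]] := h (fun i : 'I_3 => nth 2 [:: 2; 3; 5] i) (fun=> dvdn0 _).
by case: i => -[|[|[|//]]] ?; case: j => -[|[|[|//]]].
Qed.

Lemma dvdn_prime_pow p q k : prime p -> prime q -> p %| q ^ k -> p = q.
Proof. by move=> pp pq; rewrite Euclid_dvdX// dvdn_prime2// => /andP[/eqP]. Qed.

(** Split off the full powers of two primes. A third prime gives the antichain [p, q, r], and two
    exponents above 1 give [p^2, p q, q^2]. *)
Lemma no_divisor_antichain3_factor N : no_divisor_antichain3 N ->
  exists p q m, [/\ prime p, prime q, p <> q & N = p ^ m \/ N = p ^ m * q].
Proof.
move=> wid; have N0 := no_divisor_antichain3_gt0 N wid.
have [N1|N1] := eqVneq N 1; first by exists 2, 3, 0; split=> //; left.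
pose p := pdiv N.
have pp : prime p by apply: pdiv_prime; lia.
have [m cpm EN] := pfactor_coprime pp N0.
set a := logn p N in EN.
have m0 : 0 < m by move: N0; rewrite EN; case: (m).
have [m1|m1] := eqVneq m 1.
  (* [N] is a power of [p], and any other prime serves as [q]. *)
  have [q qp pq] : exists2 q, prime q & p <> q.
    by have [->|/eqP ?] := eqVneq p 2; [exists 3 | exists 2].
  by exists p, q, a; split=> //; left; rewrite EN m1 mul1n.
pose q := pdiv m.
have pq : prime q by apply: pdiv_prime; lia.
have pmq : p <> q.
  by move=> E; move: cpm; rewrite prime_coprime// E pdiv_dvd.
have [l cql Em] := pfactor_coprime pq m0.
set b := logn q m in Em.
have a0 : 0 < a by rewrite logn_gt0 mem_primes pp N0 pdiv_dvd.
have b0 : 0 < b by rewrite logn_gt0 mem_primes pq m0 pdiv_dvd.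
have l0 : 0 < l by move: m0; rewrite Em; case: (l).
have qm : q %| m by exact: pdiv_dvd.
have [l1|l1] := eqVneq l 1; last first.
  pose r := pdiv l.
  have pr : prime r by apply: pdiv_prime; lia.
  have rl : r %| l by exact: pdiv_dvd.
  have rm : r %| m by rewrite Em dvdn_mulr.
  have qr : q <> r.
    by move=> E; move: cql; rewrite prime_coprime// E rl.
  have pr' : p <> r.
    by move=> E; move: cpm; rewrite prime_coprime// E rm.
  have [] := wid (fun i : 'I_3 => nth p [:: p; q; r] i).
    by case=> -[|[|[|//]]] ? /=; rewrite ?pdiv_dvd// EN dvdn_mulr.
  move=> i [j []]; case: i => -[|[|[|//]]] ?; case: j => -[|[|[|//]]] ? //= _;
    by rewrite dvdn_prime2// => /eqP; congruence.
have {Em}EN : N = p ^ a * q ^ b by rewrite {1}EN Em l1 mul1n mulnC.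
have [b1|b1] := eqVneq b 1.
  by exists p, q, a; split=> //; right; rewrite EN b1.
(* Here [p] is the prime with exponent 1, so the two primes exchange roles. *)
have [a1|a1] := eqVneq a 1.
  by exists q, p, b; split=> //; [exact: nesym | right; rewrite EN a1 mulnC].
have [] := wid (fun i : 'I_3 => nth p [:: p ^ 2; p * q; q ^ 2] i).
  case=> -[|[|[|//]]] ? /=; rewrite EN.
  - by rewrite dvdn_mulr// dvdn_exp2l//; lia.
  - by apply: dvdn_mul; rewrite -[X in X %| _]expn1 dvdn_exp2l.
  - by rewrite dvdn_mull// dvdn_exp2l//; lia.
have p1 := prime_gt0 pp; have q1 := prime_gt0 pq.
move=> i [j []]; case: i => -[|[|[|//]]] ?; case: j => -[|[|[|//]]] ? //= _.
- by rewrite expnS expn1 dvdn_pmul2l// dvdn_prime2// => /eqP.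
- by move=> /(dvdn_trans (dvdn_mulr _ (dvdnn p)))/(dvdn_prime_pow _ _ _ pp pq).
- by rewrite -mulnn dvdn_pmul2l// dvdn_prime2// => /eqP/nesym.
- by rewrite -mulnn dvdn_pmul2r// dvdn_prime2// => /eqP.
- by move=> /(dvdn_trans (dvdn_mulr _ (dvdnn q)))/(dvdn_prime_pow _ _ _ pq pp)/nesym.
- by rewrite -mulnn dvdn_pmul2r// dvdn_prime2// => /eqP/nesym.
Qed.

Theorem theorem3p15 (R : realType) (G : AbsGroup) :
  outer_planar_group R G -> ACC_subgroups G -> DCC_subgroups G ->
  finite_group G /\
  exists p q m : nat, prime p /\ prime q /\ p <> q /\
    (iso_Zn G (p ^ m) \/ iso_Zn G (p ^ m * q)).
Proof.
move=> opG acc dcc.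
have wid := outer_planar_no_antichain3 G R opG acc dcc.
have [x gen] := no_antichain3_cyclic G acc wid.
have [N ann] := gpow_annihilator G x.
have dwid := no_antichain3_divisors G x N ann wid.
have iso := cycle_iso_Zn G x N (no_divisor_antichain3_gt0 N dwid) ann gen.
split; first exact: iso_Zn_finite iso.
have [p [q [m [pp pq npq EN]]]] := no_divisor_antichain3_factor N dwid.
exists p, q, m; do 3 split=> //.
by case: EN => <-; [left | right].
Qed.
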